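(* Let $N$ be a regular ruled surface in $E^3$ with parametrization $\vec r(s,v)=\vec c(s)+v\vec q(s)$, $\|\vec q(s)\|=1$, where $\vec c$ is the striction curve of $N$ and $s$ is the arc length parameter of $\vec c$. Let $\{\vec q,\vec h,\vec a\}$ be its Frenet frame and $k_1,k_2$ its non-zero invariants. Then $N$ is a $q$-slant ruled surface if and only if there is a fixed unit vector $\vec u$ such that the function $$\frac{k_1}{k_2}=\tan\theta$$ is constant, where $\theta$ is the angle between the ruling $\vec q$ and $\vec u$.
   Context: All maps are smooth and defined on an open interval $I\subset\mathbb R$; $E^3$ is Euclidean 3-space. $N$ is given by $\vec r(s,v)=\vec c(s)+v\vec q(s)$, where $\vec c$ is a unit speed curve and $\vec q$ is a unit vector field along $\vec c$ (the ruling). ''Regular'' refers to the base curve $\vec c$ being a regular curve (here unit speed); points where $\vec r$ fails to be an immersion are not excluded. That $\vec c$ is the striction curve means $\langle \vec c\,',\vec q\,'\rangle=0$. Frenet frame of $N$: $\vec a=\dfrac{\vec q\times\vec q\,'}{\|\vec q\,'\|}$ (central tangent), $\vec h=\vec a\times\vec q$ (central normal). The invariants $k_1,k_2$ are the functions in the Frenet formulae $$\vec q\,'=k_1\vec h,\qquad \vec h'=-k_1\vec q+k_2\vec a,\qquad \vec a'=-k_2\vec h,$$ with $'=d/ds$; both are assumed nowhere zero (so $k_1=\|\vec q\,'\|>0$). $N$ is called $q$-slant if there is a fixed unit vector $\vec u$ and a constant angle $\theta\neq\pi/2$ with $\langle\vec q(s),\vec u\rangle=\cos\theta$ for all $s$.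 *)

(* Defs.v *)
From HB Require Import structures.
From mathcomp Require Import all_boot all_order all_algebra.
From mathcomp Require Import all_classical all_reals all_analysis.
Import Order.TTheory GRing.Theory Num.Theory numFieldNormedType.Exports.

Set Implicit Arguments.
Unset Strict Implicit.
Unset Printing Implicit Defensive.

Local Open Scope classical_set_scope.
Local Open Scope ring_scope.

(* Euclidean 3-space is 'rV[R]_3.  The library norm `|u| on row vectors is the
   sup norm, so it is only used for its topology; lengths are taken with
   enorm. *)
Definition dot (R : realType) (u v : 'rV[R]_3) : R :=
  \sum_(i < 3) u 0 i * v 0 i.

Definition enorm (R : realType) (u : 'rV[R]_3) : R := Num.sqrt (dot u u).

(* Addition on 'I_3 is modulo 3, so this is the usual cyclic formula. *)
Definition cross (R : realType) (u v : 'rV[R]_3) : 'rV[R]_3 :=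
  \row_(i < 3) (u 0 (i + 1) * v 0 (i + 2%:R) - u 0 (i + 2%:R) * v 0 (i + 1)).

(* The unoriented angle, in [0, pi], between nonzero vectors. *)
Definition angle (R : realType) (u v : 'rV[R]_3) : R :=
  acos (dot u v / (enorm u * enorm v)).

Definition smooth_on (R : realType) (I : set R) (f : R -> 'rV[R]_3) : Prop :=
  forall (n : nat) (s : R), I s -> derivable (derive1n n f) s 1.

(* The curves are total functions; only their values on rs_dom, which is open,
   are meaningful, and the derivatives at points of rs_dom depend on nothing
   else. *)
Record ruled_surface (R : realType) := RuledSurface {
  rs_dom : set R;
  rs_base : R -> 'rV[R]_3;
  rs_ruling : R -> 'rV[R]_3;
  rs_dom_open : open rs_dom;
  rs_dom_interval : is_interval rs_dom;
  rs_base_smooth : smooth_on rs_dom rs_base;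
  rs_ruling_smooth : smooth_on rs_dom rs_ruling;
  rs_ruling_unit : forall s, rs_dom s -> enorm (rs_ruling s) = 1
}.

Definition rs_param (R : realType) (N : ruled_surface R) (s v : R) : 'rV[R]_3 :=
  rs_base N s + v *: rs_ruling N s.

Definition arc_length_base (R : realType) (N : ruled_surface R) : Prop :=
  forall s, rs_dom N s -> enorm (derive1 (rs_base N) s) = 1.

Definition striction_base (R : realType) (N : ruled_surface R) : Prop :=
  forall s, rs_dom N s -> dot (derive1 (rs_base N) s) (derive1 (rs_ruling N) s) = 0.

(* The Frenet frame (q, h, a); it makes sense only where q' is nonzero. *)
Definition central_tangent (R : realType) (N : ruled_surface R) (s : R) :
    'rV[R]_3 :=
  (enorm (derive1 (rs_ruling N) s))^-1 *:
    cross (rs_ruling N s) (derive1 (rs_ruling N) s).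

Definition central_normal (R : realType) (N : ruled_surface R) (s : R) :
    'rV[R]_3 :=
  cross (central_tangent N s) (rs_ruling N s).

Definition has_frenet_frame (R : realType) (N : ruled_surface R) : Prop :=
  forall s, rs_dom N s -> derive1 (rs_ruling N) s != 0.

(* k1 and k2 are the coefficient functions of the Frenet formulae.  As the
   frame is orthonormal, these equations determine them on rs_dom. *)
Definition frenet_invariants (R : realType) (N : ruled_surface R)
    (k1 k2 : R -> R) : Prop :=
  forall s, rs_dom N s ->
  [/\ derive1 (rs_ruling N) s = k1 s *: central_normal N s,
      derive1 (central_normal N) s
        = - k1 s *: rs_ruling N s + k2 s *: central_tangent N s
    & derive1 (central_tangent N) s = - k2 s *: central_normal N s].

(* The range condition on theta makes it an angle, so that theta != pi / 2
   does exclude a ruling orthogonal to u. *)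
Definition q_slant (R : realType) (N : ruled_surface R) : Prop :=
  exists u : 'rV[R]_3, enorm u = 1 /\
  exists theta : R, [/\ 0 <= theta <= pi, theta != pi / 2
    & forall s, rs_dom N s -> dot (rs_ruling N s) u = cos theta].

(* Main.v *)
(** Pairing the Frenet formulae with a fixed vector u gives <q,u>' = k1 <h,u>,
    <h,u>' = - k1 <q,u> + k2 <a,u> and <a,u>' = - k2 <h,u>.  If <q,u> is
    constant then <h,u> = 0, hence k1 / k2 = <a,u> / <q,u> with <a,u> constant,
    and <q,u>^2 + <a,u>^2 = 1 shows that this quotient is +- tan theta; the
    sign is corrected by replacing u with - u.  Conversely, the tangent
    determines an angle of [0, pi] as soon as it is nonzero. *)

Require Import Defs.
From HB Require Import structures.
From mathcomp Require Import all_boot all_order all_algebra.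
From mathcomp Require Import all_classical all_reals all_analysis.
From mathcomp Require Import ring lra.
Import Order.TTheory GRing.Theory Num.Theory numFieldNormedType.Exports.

Set Implicit Arguments.
Unset Strict Implicit.
Unset Printing Implicit Defensive.

Local Open Scope classical_set_scope.
Local Open Scope ring_scope.

(** * Coordinates, lengths and products in Euclidean 3-space *)

Lemma dotE (R : realType) (u v : 'rV[R]_3) :
  dot u v = u 0 0 * v 0 0 + u 0 1 * v 0 1 + u 0 2%:R * v 0 2%:R.
Proof.
rewrite /dot !big_ord_recl big_ord0 addr0 addrA.
(* The indices left by the expansion are matched with the numerals through their values as
   ordinals. *)
by congr (_ * _ + _ * _ + _ * _); congr (_ _ _); apply/val_inj.
Qed.

Lemma crossE (R : realType) (u v : 'rV[R]_3) :
  [/\ cross u v 0 0 = u 0 1 * v 0 2%:R - u 0 2%:R * v 0 1,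
      cross u v 0 1 = u 0 2%:R * v 0 0 - u 0 0 * v 0 2%:R
    & cross u v 0 2%:R = u 0 0 * v 0 1 - u 0 1 * v 0 0].
Proof.
by split; rewrite mxE; congr (_ * _ - _ * _); congr (_ _ _); apply/val_inj.
Qed.

Section Dot.
Context {R : realType}.
Implicit Types u v w : 'rV[R]_3.

Lemma dot_ge0 u : 0 <= dot u u.
Proof. by apply: sumr_ge0 => i _; rewrite -expr2 sqr_ge0. Qed.

Lemma dot_self_eq0 u : (dot u u == 0) = (u == 0).
Proof.
rewrite psumr_eq0 => [|i _]; last by rewrite -expr2 sqr_ge0.
apply/allP/eqP => [u0|-> i _]; last by rewrite /= mxE mul0r eqxx.
apply/rowP => i; have /= := u0 i (mem_index_enum i).
by rewrite mulf_eq0 orbb mxE => /eqP.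
Qed.

Lemma dotDl u v w : dot (u + v) w = dot u w + dot v w.
Proof. by rewrite !dotE !mxE; ring. Qed.

Lemma dotZl (k : R) u v : dot (k *: u) v = k * dot u v.
Proof. by rewrite !dotE !mxE; ring. Qed.

Lemma dotNr u v : dot u (- v) = - dot u v.
Proof. by rewrite !dotE !mxE; ring. Qed.

Lemma dot_crossr u v : dot (cross u v) v = 0.
Proof. by have [c0 c1 c2] := crossE u v; rewrite dotE c0 c1 c2; ring. Qed.

Lemma enormN u : enorm (- u) = enorm u.
Proof. by rewrite /enorm; congr Num.sqrt; rewrite !dotE !mxE; ring. Qed.

Lemma enorm_eq1 u : enorm u = 1 -> dot u u = 1.
Proof. by move=> u1; rewrite -(sqr_sqrtr (dot_ge0 u)) -/(enorm u) u1 expr1n. Qed.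

Lemma enorm_neq0 u : u != 0 -> enorm u != 0.
Proof. by move=> u0; rewrite gt_eqF// sqrtr_gt0 lt0r dot_self_eq0 u0 dot_ge0. Qed.

(* The square of a triple product is a Gram determinant. *)
Lemma dot_cross_sqr u v w :
  dot (cross u v) w ^+ 2 =
    dot u u * dot v v * dot w w + 2 * (dot u v * dot v w * dot u w)
    - dot u u * dot v w ^+ 2 - dot v v * dot u w ^+ 2 - dot w w * dot u v ^+ 2.
Proof.
by have [c0 c1 c2] := crossE u v; rewrite !dotE c0 c1 c2; ring.
Qed.

(** The component of [u] orthogonal to [v] has squared length 1 - <u,v>^2, which is nonnegative. *)
Lemma cauchy_schwarz_unit u v : enorm u = 1 -> enorm v = 1 -> -1 <= dot u v <= 1.
Proof.
move=> /enorm_eq1 u1 /enorm_eq1 v1.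
have := dot_ge0 (u - dot u v *: v).
rewrite dotE !mxE.
have -> : (u 0 0 - dot u v * v 0 0) * (u 0 0 - dot u v * v 0 0) +
    (u 0 1 - dot u v * v 0 1) * (u 0 1 - dot u v * v 0 1) +
    (u 0 2%:R - dot u v * v 0 2%:R) * (u 0 2%:R - dot u v * v 0 2%:R) =
    dot u u - 2 * dot u v ^+ 2 + dot u v ^+ 2 * dot v v.
  by rewrite !dotE; ring.
by rewrite u1 v1 => ?; apply/andP; split; nra.
Qed.

Lemma angle_unit u v : enorm u = 1 -> enorm v = 1 -> angle u v = acos (dot u v).
Proof. by move=> u1 v1; rewrite /angle u1 v1 mulr1 divr1. Qed.

End Dot.

(** * Differentiation of vector functions, and constancy on intervals *)

Section Derivatives.
Context {R : realType}.
Implicit Types (f g : R -> 'rV[R]_3) (u : 'rV[R]_3) (s : R).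

Lemma is_derive_dotl f u s : derivable f s 1 ->
  is_derive s 1 (fun t => dot (f t) u) (dot (derive1 f s) u).
Proof.
move=> fs; have fis i : derivable (fun t => f t 0 i) s 1.
  exact: (derivable_mxP _ _ _).1.
rewrite derive1E derive_mx// /dot.
have -> : (fun t => \sum_(i < 3) f t 0 i * u 0 i) =
    \sum_(i < 3) (u 0 i \*: (fun t => f t 0 i : R^o)).
  apply/funext => t; rewrite fct_sumE; apply: eq_bigr => i _.
  by rewrite /= mulrC.
apply: is_derive_eq.
  by apply: is_derive_sum => i; apply: is_deriveZ; exact/derivableP.
by apply: eq_bigr => i _; rewrite mxE mulrC.
Qed.

Lemma derivable_dot f g s :
  derivable f s 1 -> derivable g s 1 -> derivable (fun t => dot (f t) (g t)) s 1.
Proof.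
move=> /derivable_mxP fs /derivable_mxP gs.
have -> : (fun t => dot (f t) (g t)) =
    \sum_(i < 3) ((fun t => f t 0 i) * (fun t => g t 0 i)).
  by apply/funext => t; rewrite fct_sumE.
by apply: derivable_sum => i; exact: derivableM.
Qed.

Lemma derivable_cross f g s : derivable f s 1 -> derivable g s 1 ->
  derivable (fun t => cross (f t) (g t)) s 1.
Proof.
move=> /derivable_mxP fs /derivable_mxP gs; apply/derivable_mxP => i j.
have -> : (fun t => cross (f t) (g t) i j) =
    (fun t => f t 0 (j + 1)) * (fun t => g t 0 (j + 2%:R)) -
    (fun t => f t 0 (j + 2%:R)) * (fun t => g t 0 (j + 1)).
  by apply/funext => t; rewrite mxE.
by apply: derivableB; exact: derivableM.
Qed.

Lemma derivable_scale (k : R -> R) f s : derivable k s 1 -> derivable f s 1 ->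
  derivable (fun t => k t *: f t) s 1.
Proof.
move=> ks /derivable_mxP fs; apply/derivable_mxP => i j.
have -> : (fun t => (k t *: f t) i j) = k * (fun t => f t i j).
  by apply/funext => t; rewrite mxE.
exact: derivableM.
Qed.

(** Since [f s != 0], the square root is taken at a positive argument, where it is
    differentiable. *)
Lemma derivable_enorm f s :
  f s != 0 -> derivable f s 1 -> derivable (fun t => enorm (f t)) s 1.
Proof.
move=> fs0 fs; apply/derivable1_diffP.
apply: (@differentiable_comp _ _ _ _ (fun t => dot (f t) (f t)) Num.sqrt).
  by apply/derivable1_diffP; exact: derivable_dot.
apply/derivable1_diffP.
have : 0 < dot (f s) (f s) by rewrite lt0r dot_self_eq0 fs0 dot_ge0.
by move=> /is_derive1_sqrt[].
Qed.

(** As [A] is open, [f] agrees with a constant near [s], and derivatives are local. *)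
Lemma is_derive_cst_on {A : set R} (Ao : open A) {f : R -> R} {c s df} :
  (forall t, A t -> f t = c) -> A s -> is_derive s 1 f df -> df = 0.
Proof.
move=> fc As [_ <-].
rewrite -(derive_cst c s (1 : R)); apply: near_eq_derive.
by apply: filterS (open_nbhs_nbhs (conj Ao As)) => t /fc.
Qed.

(** This is the mean value theorem on the segment from [s] to [t], which lies in the interval
    [A]. *)
Lemma derive0_cst_on {A : set R} (Ai : is_interval A) {f : R -> R} :
  (forall t, A t -> is_derive t 1 f 0) -> forall s t, A s -> A t -> f s = f t.
Proof.
move=> f0 s t; wlog st : s t / s <= t => [H|As At].
  by case: (leP s t) => [/H|/ltW /H H' As At]; [exact|rewrite H'].
have stA x : x \in `[s, t] -> A x by rewrite in_itv/=; exact: Ai.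
have fc : {within `[s, t], continuous f}.
  by apply: derivable_within_continuous => x /stA/f0[].
have [x xst|x _] := MVT_segment (df := fun=> 0) st _ fc.
  by apply/f0/stA; exact: subset_itv_oo_cc.
by rewrite mul0r => /eqP; rewrite subr_eq0 => /eqP ->.
Qed.

End Derivatives.

(** * Tangents of angles of [0, pi] in terms of their cosines *)

Section Tangent.
Context {R : realType}.
Implicit Types c x y : R.

Lemma acos_eq_pi2 c : -1 <= c <= 1 -> (acos c == pi / 2) = (c == 0).
Proof.
move=> c1; apply/eqP/eqP => [|->]; last exact: acos0.
by move=> /(congr1 cos); rewrite acosK ?in_itv// cos_pihalf.
Qed.

Lemma tan_acos c : -1 <= c <= 1 -> tan (acos c) = Num.sqrt (1 - c ^+ 2) / c.
Proof. by move=> c1; rewrite /tan sin_acos// acosK ?in_itv. Qed.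

(** Squaring gives x^2 = y^2, and y = - x is impossible because on [0, pi] the tangent has the sign
    of the cosine. A nonzero tangent excludes the cosines 1 and -1, and also 0, where division by 0
    makes the tangent 0. *)
Lemma tan_acos_inj x y : -1 <= x <= 1 -> -1 <= y <= 1 ->
  tan (acos x) = tan (acos y) -> tan (acos x) != 0 -> x = y.
Proof.
move=> x1 y1; rewrite !tan_acos// => xy tx0.
have x0 : x != 0 by apply: contraNneq tx0 => ->; rewrite invr0 mulr0.
have y0 : y != 0 by apply: contraNneq tx0 => y0; rewrite xy y0 invr0 mulr0.
have sx : Num.sqrt (1 - x ^+ 2) != 0.
  by apply: contraNneq tx0 => ->; rewrite mul0r.
have Sx : Num.sqrt (1 - x ^+ 2) ^+ 2 = 1 - x ^+ 2 by rewrite sqr_sqrtr//; nra.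
have Sy : Num.sqrt (1 - y ^+ 2) ^+ 2 = 1 - y ^+ 2 by rewrite sqr_sqrtr//; nra.
have gx : 0 < Num.sqrt (1 - x ^+ 2) by rewrite lt0r sx sqrtr_ge0.
have gy := sqrtr_ge0 (1 - y ^+ 2).
have {}xy : Num.sqrt (1 - x ^+ 2) * y = Num.sqrt (1 - y ^+ 2) * x.
  by apply/eqP; rewrite -eqr_div// xy.
(* In (1 - x^2) y^2 = (1 - y^2) x^2 the terms x^2 y^2 cancel. *)
have xy2 : (y - x) * (y + x) = 0.
  have := congr1 (fun z => z ^+ 2) xy.
  by rewrite !exprMn Sx Sy => ?; lra.
move/eqP : xy2; rewrite mulf_eq0 => /orP[|/eqP yx].
  by rewrite subr_eq0 => /eqP.
have {}yx : y = - x by lra.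
move: xy gx; rewrite yx sqrrN.
by rewrite mulrN -mulNr => /(mulIf x0); lra.
Qed.

End Tangent.

(** * The Frenet frame paired with a fixed vector *)

Section Frenet.
Context {R : realType} {N : ruled_surface R} {k1 k2 : R -> R}.
Hypothesis frame : has_frenet_frame N.
Hypothesis inv : frenet_invariants N k1 k2.
Let I := rs_dom N.
Let q := rs_ruling N.
Let h := central_normal N.
Let a := central_tangent N.

Lemma derivable_ruling s : I s -> derivable q s 1.
Proof. by move=> Is; have := @rs_ruling_smooth _ N 0%N s Is. Qed.

(** The Frenet formulae only give values of [derive1]; derivability comes from the smoothness of the
    ruling, with q' nonzero for the normalization. *)
Lemma derivable_central_tangent s : I s -> derivable a s 1.
Proof.
move=> Is; have q's : derivable (derive1 q) s 1 by have := @rs_ruling_smooth _ N 1%N s Is.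
apply: derivable_scale.
  apply: derivableV; first exact/enorm_neq0/frame.
  by apply: derivable_enorm => //; exact: frame.
by apply: derivable_cross => //; exact: derivable_ruling.
Qed.

Lemma derivable_central_normal s : I s -> derivable h s 1.
Proof.
move=> Is; apply: derivable_cross; last exact: derivable_ruling.
exact: derivable_central_tangent.
Qed.

Lemma is_derive_ruling_dot u s : I s ->
  is_derive s 1 (fun t => dot (q t) u) (k1 s * dot (h s) u).
Proof.
move=> Is; apply: is_derive_eq; first exact/is_derive_dotl/derivable_ruling.
by have [-> _ _] := inv Is; rewrite dotZl.
Qed.

Lemma is_derive_central_normal_dot u s : I s ->
  is_derive s 1 (fun t => dot (h t) u) (- k1 s * dot (q s) u + k2 s * dot (a s) u).
Proof.
move=> Is; apply: is_derive_eq.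
  exact/is_derive_dotl/derivable_central_normal.
by have [_ -> _] := inv Is; rewrite dotDl !dotZl.
Qed.

Lemma is_derive_central_tangent_dot u s : I s ->
  is_derive s 1 (fun t => dot (a t) u) (- k2 s * dot (h s) u).
Proof.
move=> Is; apply: is_derive_eq.
  exact/is_derive_dotl/derivable_central_tangent.
by have [_ _ ->] := inv Is; rewrite dotZl.
Qed.

(** Pythagoras for a unit vector in the plane of q and a. As q' is orthogonal to both q and u, the
    Gram determinant reduces <q x q',u>^2 to |q'|^2 (1 - <q,u>^2). *)
Lemma ruling_central_tangent_sqr u s : I s -> enorm u = 1 -> dot (h s) u = 0 ->
  dot (q s) u ^+ 2 + dot (a s) u ^+ 2 = 1.
Proof.
move=> Is /enorm_eq1 u1 hu; have [q'h _ _] := inv Is.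
have q1 := enorm_eq1 (rs_ruling_unit Is).
have n0 := enorm_neq0 (frame Is).
have n2 : enorm (derive1 q s) ^+ 2 = dot (derive1 q s) (derive1 q s).
  by rewrite sqr_sqrtr ?dot_ge0.
have dot_sym (v w : 'rV[R]_3) : dot v w = dot w v by rewrite !dotE; ring.
have qq' : dot (q s) (derive1 q s) = 0.
  by rewrite dot_sym [derive1 q s]q'h dotZl dot_crossr mulr0.
have q'u : dot (derive1 q s) u = 0 by rewrite [derive1 q s]q'h dotZl hu mulr0.
rewrite [a s]/(_ *: _) dotZl exprMn dot_cross_sqr qq' q'u u1 q1 -n2 exprVn.
by rewrite -/q; field.
Qed.

End Frenet.

Theorem theorem3p1 (R : realType) (N : ruled_surface R) (k1 k2 : R -> R)
    (N_striction : striction_base N) (N_arc_length : arc_length_base N)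
    (N_frame : has_frenet_frame N) (N_inv : frenet_invariants N k1 k2)
    (k1_neq0 : forall s, rs_dom N s -> k1 s != 0)
    (k2_neq0 : forall s, rs_dom N s -> k2 s != 0) :
  q_slant N <->
  exists u : 'rV[R]_3, enorm u = 1 /\
    exists m : R, forall s : R, rs_dom N s ->
      [/\ angle (rs_ruling N s) u != pi / 2,
          k1 s / k2 s = tan (angle (rs_ruling N s) u)
        & k1 s / k2 s = m].
Proof.
(* Over an empty domain both sides hold vacuously, with theta = 0; otherwise [s0] serves as base
   point. *)
have [[s0 Is0]|dom0] := pselect (exists s, rs_dom N s); last first.
  have no s : ~ rs_dom N s by move=> Is; apply: dom0; exists s.
  split=> -[u [u1 _]]; exists u; split=> //; first by exists 0 => s /no.
  exists 0; split=> [| |s /no//]; first by rewrite lexx pi_ge0.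
  by rewrite eq_sym mulf_neq0 ?gt_eqF ?pi_gt0 ?invr_gt0.
have q1 := @rs_ruling_unit _ N.
split=> [[u [u1 [theta [theta_itv theta_neq qu]]]]|[u [u1 [m km]]]].
  have c1 : -1 <= cos theta <= 1 by rewrite cos_geN1 cos_le1.
  have c0 : cos theta != 0 by rewrite -acos_eq_pi2// cosK ?in_itv.
  have hu s : rs_dom N s -> dot (central_normal N s) u = 0.
    move=> Is; have := is_derive_cst_on (@rs_dom_open _ N) qu Is
      (is_derive_ruling_dot N_inv u Is).
    by move/eqP; rewrite mulf_eq0 (negbTE (k1_neq0 _ Is)) => /eqP.
  have au s : rs_dom N s ->
      dot (central_tangent N s) u = dot (central_tangent N s0) u.
    move=> Is; apply: (derive0_cst_on (@rs_dom_interval _ N)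
      (f := fun t => dot (central_tangent N t) u)) => // t It.
    apply: is_derive_eq; first exact: (is_derive_central_tangent_dot N_frame N_inv).
    by rewrite hu// mulr0.
  (* Since <h,u> vanishes identically, so does its derivative - k1 cos theta + k2 <a,u>. *)
  have kE s : rs_dom N s ->
      k1 s / k2 s = dot (central_tangent N s0) u / cos theta.
    move=> Is; have := is_derive_cst_on (@rs_dom_open _ N) hu Is
      (is_derive_central_normal_dot N_frame N_inv u Is).
    rewrite qu// au// => ?; apply/eqP; rewrite eqr_div ?k2_neq0//; apply/eqP; lra.
  have := ruling_central_tangent_sqr N_frame N_inv Is0 u1 (hu s0 Is0).
  rewrite qu//; set d := dot (central_tangent N s0) u in kE * => cd.
  have dE : Num.sqrt (1 - cos theta ^+ 2) = `|d|.
    by rewrite -cd addrAC subrr add0r sqrtr_sqr.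
  have [d0|d0] := leP 0 d.
    exists u; split=> //; exists (d / cos theta) => s Is.
    rewrite angle_unit ?q1// qu// acos_eq_pi2// tan_acos// dE ger0_norm//.
    by split=> //; exact: kE.
  (* For d < 0 the angle with - u has cosine - cos theta and tangent |d| / (- cos theta) = d / cos
     theta. *)
  exists (- u); rewrite enormN; split=> //; exists (d / cos theta) => s Is.
  have Nc1 : -1 <= - cos theta <= 1 by rewrite lerN2 lerNl andbC.
  rewrite angle_unit ?q1 ?enormN// dotNr qu// acos_eq_pi2// oppr_eq0.
  rewrite tan_acos// sqrrN dE ltr0_norm// invrN mulrNN.
  by split=> //; exact: kE.
have qu1 s : rs_dom N s -> -1 <= dot (rs_ruling N s) u <= 1.
  by move=> /q1 ?; exact: cauchy_schwarz_unit.
(* The constant angle is the one at the base point. *)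
exists u; split=> //; exists (acos (dot (rs_ruling N s0) u)).
have [ang _ _] := km _ Is0; rewrite angle_unit ?q1// in ang.
split=> // [|s Is]; first by rewrite acos_ge0 ?acos_lepi// qu1.
rewrite acosK ?in_itv/= ?qu1//.
have [_ t0 m0] := km _ Is0; have [_ t1 m1] := km _ Is.
rewrite angle_unit ?q1// in t0; rewrite angle_unit ?q1// in t1.
(* Both tangents equal [m], which is nonzero because k1 is, so the cosines at [s] and [s0] agree. *)
apply: tan_acos_inj; rewrite ?qu1// -?t1 ?m1 -?t0 ?m0//.
by rewrite -m0 mulf_neq0 ?invr_eq0 ?k1_neq0 ?k2_neq0.
Qed.
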